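(* Let $\lambda\in[0,1]$ with $\lambda\notin\{0,1\}$, and let $0<\gamma<\gamma_{\max}(\lambda)$. Then the observables $\mathsf{A}_\lambda$ and $\mathsf{B}_\gamma$ have a joint observable which is an informationally complete covariant phase space observable.
   Context: Let $\mathcal{H}$ be a complex Hilbert space with $\dim\mathcal{H}=d\ge 2$ (inner product linear in the second argument), $\mathcal{L(H)}$ the linear operators on $\mathcal{H}$, and $\mathcal{S(H)}$ the set of states (positive operators of trace one). $\mathbb{Z}_d=\{0,\dots,d-1\}$ with arithmetic modulo $d$, and $\omega=e^{2\pi i/d}$. An observable with finite outcome set $\Omega$ is a map $x\mapsto\mathsf{E}(x)$ from $\Omega$ to positive operators on $\mathcal{H}$ with $\sum_{x\in\Omega}\mathsf{E}(x)=\mathbb{1}$. Fix an orthonormal basis $\{\varphi_j\}_{j\in\mathbb{Z}_d}$ of $\mathcal{H}$ and set $\psi_k=\frac{1}{\sqrt d}\sum_{h\in\mathbb{Z}_d}\omega^{hk}\varphi_h$ for $k\in\mathbb{Z}_d$; $\{\psi_k\}$ is an orthonormal basis. Put $\mathsf{A}(j)=|\varphi_j\rangle\langle\varphi_j|$, $\mathsf{B}(k)=|\psi_k\rangle\langle\psi_k|$, and for $\lambda,\gamma\in[0,1]$ define observables on $\mathbb{Z}_d$ by $\mathsf{A}_\lambda(j)=\lambda\mathsf{A}(j)+(1-\lambda)\frac1d\mathbb{1}$ and $\mathsf{B}_\gamma(k)=\gamma\mathsf{B}(k)+(1-\gamma)\frac1d\mathbb{1}$. A joint observable of two observables $\mathsf{E},\mathsf{F}$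 on $\mathbb{Z}_d$ is an observable $\mathsf{C}$ on $\mathbb{Z}_d\times\mathbb{Z}_d$ with $\sum_{k}\mathsf{C}(j,k)=\mathsf{E}(j)$ for all $j$ and $\sum_{j}\mathsf{C}(j,k)=\mathsf{F}(k)$ for all $k$; $\mathsf{E}$ and $\mathsf{F}$ are jointly measurable if a joint observable exists. For $\lambda\in[0,1]$, $\gamma_{\max}(\lambda)$ denotes the largest $\gamma\in[0,1]$ such that $\mathsf{A}_\lambda$ and $\mathsf{B}_\gamma$ are jointly measurable (this maximum exists, and $\mathsf{A}_\lambda,\mathsf{B}_\gamma$ are jointly measurable iff $0\le\gamma\le\gamma_{\max}(\lambda)$). Let $U_x\varphi_k=\varphi_{k+x}$ and $V_y\varphi_k=\omega^{yk}\varphi_k$ for $x,y,k\in\mathbb{Z}_d$. An observable $\mathsf{C}$ on $\mathbb{Z}_d\times\mathbb{Z}_d$ is a covariant phase space observable if $U_xV_y\mathsf{C}(j,k)V_y^*U_x^*=\mathsf{C}(j+x,k+y)$ for all $j,k,x,y\in\mathbb{Z}_d$. An observable $\mathsf{C}$ with outcome set $\Omega$ is informationally complete if for all states $\varrho_1,\varrho_2\in\mathcal{S(H)}$, $\mathrm{tr}[\varrho_1\mathsf{C}(\omega')]=\mathrm{tr}[\varrho_2\mathsf{C}(\omega')]$ for all $\omega'\in\Omega$ implies $\varrho_1=\varrho_2$; equivalently, the linear span of $\{\mathsf{C}(\omega'):\omega'\in\Omega\}$ is $\mathcal{L(H)}$. *)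

(* Defs.v *)
From HB Require Import structures.
From mathcomp Require Import all_boot all_order all_algebra.
From mathcomp Require Import complex.
From mathcomp Require Import classical_sets reals trigo.

Set Implicit Arguments.
Unset Strict Implicit.
Unset Printing Implicit Defensive.

Import Order.TTheory GRing.Theory Num.Theory.

Local Open Scope ring_scope.
Local Open Scope complex_scope.

(* A finite-dimensional complex Hilbert space is a vectType over R[i] together
   with a positive definite Hermitian form; completeness is automatic, and all
   operators are bounded, so the operators on H are 'End(H). *)
Section Operators.
Context {R : realType} {H : vectType R[i]}.
Variable ip : {dot H for Num.conj}.

(* {dot H for Num.conj} is linear in its first argument; <u|v> is linear in the
   second. *)
Definition braket (u v : H) : R[i] := ip v u.

Definition ketbra (u v : H) : 'End(H) := linfun (fun w => braket v w *: u).

Definition positive_op (T : 'End(H)) : Prop :=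
  forall v : H, 0 <= braket v (T v).

(* The trace of the matrix of T in one fixed basis of H; it does not depend on
   the basis. *)
Definition optrace (T : 'End(H)) : R[i] :=
  \tr (passmx.mxof (vbasis {:H}) (vbasis {:H}) T).

Definition is_state (rho : 'End(H)) : Prop :=
  positive_op rho /\ optrace rho = 1.

Definition is_adjoint (T S : 'End(H)) : Prop :=
  forall u v : H, braket u (T v) = braket (S u) v.

(* The adjoint always exists (see adjointP) and is unique, so the default value
   0 is irrelevant. *)
Definition adjoint (T : 'End(H)) : 'End(H) :=
  xget 0 (fun S : 'End(H) => is_adjoint T S).

Definition observable (Omega : finType) (E : Omega -> 'End(H)) : Prop :=
  (forall x, positive_op (E x)) /\ \sum_x E x = \1%VF.

Definition joint_observable (Omega1 Omega2 : finType)
    (E : Omega1 -> 'End(H)) (F : Omega2 -> 'End(H))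
    (C : Omega1 * Omega2 -> 'End(H)) : Prop :=
  [/\ observable C,
      forall j, \sum_k C (j, k) = E j
    & forall k, \sum_j C (j, k) = F k].

Definition jointly_measurable (Omega1 Omega2 : finType)
    (E : Omega1 -> 'End(H)) (F : Omega2 -> 'End(H)) : Prop :=
  exists C, joint_observable E F C.

Definition informationally_complete (Omega : finType)
    (C : Omega -> 'End(H)) : Prop :=
  forall rho1 rho2 : 'End(H), is_state rho1 -> is_state rho2 ->
    (forall x, optrace (rho1 \o C x)%VF = optrace (rho2 \o C x)%VF) ->
    rho1 = rho2.

Lemma ketbraE (u v w : H) : ketbra u v w = braket v w *: u.
Proof.
pose f w0 := braket v w0 *: u.
have lf : linear f.
  by move=> a x y; rewrite /f /braket linearPl scalerDl -scalerA.
pose mf := GRing.isLinear.Build R[i] H H _ f lf.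
pose F : {linear H -> H} := HB.pack f mf.
by rewrite /ketbra (lfunE F).
Qed.

End Operators.

(* 'Z_d is Z/dZ only for d >= 2, so these notions are meant for such d. *)
Section FourierPair.
Context {R : realType} {H : vectType R[i]}.
Variables (ip : {dot H for Num.conj}) (d : nat) (phi : 'Z_d -> H).

Definition orthonormal_basis : Prop :=
  orthonormal ip (codom phi) /\ basis_of {:H} (codom phi).

Definition omega : R[i] :=
  cos (2 * pi / d%:R) +i* sin (2 * pi / d%:R).

Definition fourier (k : 'Z_d) : H :=
  ((Num.sqrt d%:R)^-1 : R)%:C *: \sum_(h : 'Z_d) omega ^+ (h * k)%N *: phi h.

Definition smear (t : R) (T : 'End(H)) : 'End(H) :=
  t%:C *: T + (1 - t)%:C *: (d%:R^-1 *: \1%VF).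

Definition A_ (lambda : R) (j : 'Z_d) : 'End(H) :=
  smear lambda (ketbra ip (phi j) (phi j)).

Definition B_ (gamma : R) (k : 'Z_d) : 'End(H) :=
  smear gamma (ketbra ip (fourier k) (fourier k)).

Definition is_gamma_max (lambda g : R) : Prop :=
  [/\ 0 <= g <= 1,
      jointly_measurable ip (A_ lambda) (B_ g)
    & forall g', 0 <= g' <= 1 ->
        jointly_measurable ip (A_ lambda) (B_ g') -> g' <= g].

(* U_x and V_y, given by their values on the basis phi (see shift_opE and
   phase_opE). *)
Definition shift_op (x : 'Z_d) : 'End(H) :=
  \sum_(k : 'Z_d) ketbra ip (phi (k + x)) (phi k).

Definition phase_op (y : 'Z_d) : 'End(H) :=
  \sum_(k : 'Z_d) omega ^+ (y * k)%N *: ketbra ip (phi k) (phi k).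

Definition covariant_phase_space_observable
    (C : 'Z_d * 'Z_d -> 'End(H)) : Prop :=
  observable ip C /\
  forall j k x y : 'Z_d,
    (shift_op x \o phase_op y \o C (j, k)
       \o adjoint ip (phase_op y) \o adjoint ip (shift_op x))%VF
    = C (j + x, k + y).

Lemma orthonormal_basisE (i j : 'Z_d) :
  orthonormal_basis -> braket ip (phi i) (phi j) = (i == j)%:R.
Proof.
move=> [/orthonormalP/= [uphi ophi] _].
rewrite /braket ophi ?codom_f// eq_sym; congr (nat_of_bool _)%:R.
have /injectiveP injphi : injectiveb phi by rewrite /injectiveb /dinjectiveb.
exact: (inj_eq injphi).
Qed.

Lemma basis_expansion (v : H) : orthonormal_basis ->
  v = \sum_j braket ip (phi j) v *: phi j.
Proof.
move=> hphi; have [_ bphi] := hphi.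
suff [c ->] : exists c : 'Z_d -> R[i], v = \sum_j c j *: phi j.
  apply: eq_bigr => j _; congr (_ *: _).
  rewrite /braket linear_sumlz (bigD1 j)//= big1 => [|i ij].
    by rewrite linearZl_LR/= -/(braket _ _ _) orthonormal_basisE// eqxx mulr1 addr0.
  rewrite linearZl_LR/= -/(braket _ _ _) orthonormal_basisE//.
  by rewrite eq_sym (negbTE ij) mulr0.
have : v \in <<codom phi>>%VS by rewrite (span_basis bphi) memvf.
rewrite span_def big_map big_enum/= => /memv_sumP [vs hvs ->].
exists (fun j => sval (sig_eqW (vlineP _ _ (hvs j isT)))).
by apply: eq_bigr => j _; case: sig_eqW.
Qed.

Lemma adjointP (T : 'End(H)) : orthonormal_basis ->
  is_adjoint ip T (adjoint ip T).
Proof.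
move=> hphi; rewrite /adjoint; case: xgetP => [S _ //|noS].
case: (noS (\sum_j ketbra ip (phi j) (T (phi j)))) => u v.
rewrite sum_lfunE {1}(basis_expansion v hphi) linear_sum /=.
rewrite /braket linear_sumlz linear_sumr; apply: eq_bigr => j _.
rewrite ketbraE linearZ/= linearZl_LR/= linearZr_LR/= mulrC; congr (_ * _).
by rewrite /braket hermC expr0 mul1r.
Qed.

Lemma shift_opE (x k : 'Z_d) : orthonormal_basis ->
  shift_op x (phi k) = phi (k + x).
Proof.
move=> hphi; rewrite sum_lfunE (bigD1 k)//= big1 => [|i ik].
  by rewrite ketbraE orthonormal_basisE// eqxx scale1r addr0.
by rewrite ketbraE orthonormal_basisE// (negbTE ik) scale0r.
Qed.

Lemma phase_opE (y k : 'Z_d) : orthonormal_basis ->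
  phase_op y (phi k) = omega ^+ (y * k)%N *: phi k.
Proof.
move=> hphi; rewrite sum_lfunE (bigD1 k)//= big1 => [|i ik].
  by rewrite lfunE/= ketbraE orthonormal_basisE// eqxx scale1r addr0.
by rewrite lfunE/= ketbraE orthonormal_basisE// (negbTE ik) scale0r scaler0.
Qed.

End FourierPair.

(* Main.v *)
Require Import Defs.
From HB Require Import structures.
From mathcomp Require Import all_boot all_order all_algebra.
From mathcomp Require Import complex.
From mathcomp Require Import classical_sets reals trigo.
From mathcomp Require Import ring lra.

Set Implicit Arguments.
Unset Strict Implicit.
Unset Printing Implicit Defensive.

Import Order.TTheory GRing.Theory Num.Theory.

Local Open Scope ring_scope.

(** Averaging a joint observable of [A_lambda] and [B_gamma_max] over the
    Weyl-Heisenberg group gives a positive kernel [T] whose orbit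
    [C(j,k) = W_jk T W_jk^*] has the same margins.  The diagonal state
    proportional to [A_lambda(0)] is strictly positive because [lambda < 1], and
    its orbit has margins [A_lambda] and [B_0].  Since [gamma < gamma_max], a
    convex combination of both seeds has margins [A_lambda], [B_gamma] and is
    strictly positive, so it may be perturbed by any small Hermitian kernel that
    does not change the margins.  The orbit of a seed [T] is informationally
    complete as soon as no Weyl coefficient [tr (T W_xy)] vanishes: those with
    [x = 0] or [y = 0] are fixed by the margins and nonzero because
    [lambda, gamma > 0], and a generic perturbation makes the others nonzero. *)

(** * Generic parameters in affine families *)

(** The product of the affine polynomials [p i + q i X] is a nonzero polynomial, so its finitely
    many roots cannot exhaust the points [eps / n.+1] of the interval from 0 to [eps]. *)
Lemma affine_nonvanishing (C : numFieldType) (I : finType) (p q : I -> C)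
    (eps : C) :
  0 < eps -> (forall i, (p i != 0) || (q i != 0)) ->
  exists t, [/\ 0 < t, t <= eps & forall i, p i + t * q i != 0].
Proof.
move=> eps0 pq.
pose P := \prod_i ((p i)%:P + q i *: 'X).
have P0 : P != 0.
  apply/prodf_neq0 => i _; apply/eqP => /polyP h.
  move: (h 0%N) (h 1%N) (pq i).
  rewrite !coefD !coefZ !coefC !coefX ?coef0 /= mulr0 mulr1 addr0 add0r.
  by move=> -> ->; rewrite eqxx.
(* A nonzero [P] has fewer than [size P] roots, so [size P] distinct candidates suffice. *)
pose rs := [seq eps / n.+1%:R | n <- iota 0 (size P)].
have urs : uniq rs.
  rewrite map_inj_uniq ?iota_uniq// => m n /(mulfI (lt0r_neq0 eps0)).
  by move=> /invr_inj /eqP; rewrite eqr_nat => /eqP [].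
have /allPn [t /mapP [n _ ->]] : ~~ all (root P) rs.
  apply/negP => ars; have := max_poly_roots P0 ars urs.
  by rewrite size_map size_iota ltnn.
rewrite /root horner_prod; move=> /prodf_neq0 Pt.
exists (eps / n.+1%:R); split.
- by rewrite divr_gt0 ?ltr0n.
- by rewrite ler_pdivrMr ?ltr0n// ler_peMr ?ler1n ?ltW.
- by move=> i; have := Pt i isT; rewrite !hornerE [_ / _ * q i]mulrC mulrA.
Qed.

(** * Positive kernels *)

Section Kernels.
Variables (C : numClosedFieldType) (I : finType).
Implicit Types (M N : I -> I -> C) (v : I -> C).

Definition qform M v : C := \sum_a \sum_b (v a)^* * M a b * v b.

(** In the order of [C], being nonnegative includes being real, so such a kernel is automatically
    Hermitian. *)
Definition psd M : Prop := forall v, 0 <= qform M v.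

Lemma eq_qform M N v : (forall a b, M a b = N a b) -> qform M v = qform N v.
Proof. by move=> h; do 2![apply: eq_bigr => ? _]; rewrite h. Qed.

Lemma qformDZ (s t : C) M N v :
  qform (fun a b => s * M a b + t * N a b) v = s * qform M v + t * qform N v.
Proof.
rewrite /qform !mulr_sumr -big_split; apply: eq_bigr => a _ /=.
rewrite !mulr_sumr -big_split; apply: eq_bigr => b _ /=.
by ring.
Qed.

Lemma qform_real M v : (forall a b, M b a = (M a b)^*) ->
  qform M v \is Num.real.
Proof.
move=> hM; apply/CrealP; rewrite /qform rmorph_sum exchange_big /=.
apply: eq_bigr => a _; rewrite rmorph_sum; apply: eq_bigr => b _ /=.
by rewrite !rmorphM /= conjCK -hM; ring.
Qed.

Lemma qform_diag (f : I -> C) v :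
  qform (fun a b => (a == b)%:R * f a) v = \sum_a f a * `|v a| ^+ 2.
Proof.
apply: eq_bigr => a _; rewrite (bigD1 a) //= big1 => [|b /negbTE ba].
  by rewrite eqxx addr0 normCK mul1r; ring.
by rewrite eq_sym ba !(mul0r, mulr0).
Qed.

Lemma norm_qform_le M v :
  `|qform M v| <= (\sum_a \sum_b `|M a b|) * \sum_a `|v a| ^+ 2.
Proof.
set N := \sum_a `|v a| ^+ 2.
have vN a : `|v a| ^+ 2 <= N.
  by rewrite /N (bigD1 a) //= lerDl sumr_ge0 // => b _; rewrite exprn_ge0.
apply: le_trans (ler_norm_sum _ _ _) _; rewrite mulr_suml; apply: ler_sum => a _.
apply: le_trans (ler_norm_sum _ _ _) _; rewrite mulr_suml; apply: ler_sum => b _.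
rewrite !normrM norm_conjC mulrAC mulrC ler_wpM2l //.
(* After doubling, the bound on [|v a| |v b|] is the arithmetic-geometric mean inequality. *)
rewrite -(@ler_pM2l _ 2) //.
have h : 0 <= (`|v a| - `|v b|) ^+ 2.
  by apply: real_exprn_even_ge0 => //; rewrite rpredB ?normr_real.
apply: (@le_trans _ _ (`|v a| ^+ 2 + `|v b| ^+ 2)).
  by rewrite -subr_ge0; rewrite (_ : _ - _ = (`|v a| - `|v b|) ^+ 2) //; ring.
by rewrite mulr_natl mulr2n lerD.
Qed.

Lemma psd_perturb M N (c : C) :
    0 < c -> (forall v, c * \sum_a `|v a| ^+ 2 <= qform M v) ->
    (forall a b, N b a = (N a b)^*) ->
  exists2 eps, 0 < eps &
    forall t, 0 <= t -> t <= eps -> psd (fun a b => M a b + t * N a b).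
Proof.
move=> c0 hM hN; set K := \sum_a \sum_b `|N a b|.
have K0 : 0 <= K by rewrite sumr_ge0 // => a _; rewrite sumr_ge0.
have K1 : 0 < K + 1 by rewrite ltr_wpDl.
(* [K] bounds the form of [N] relative to the squared norm of [v]; the added 1 keeps the quotient
   meaningful when [N] is zero. *)
exists (c / (K + 1)) => [|t t0 ht v]; first by rewrite divr_gt0.
rewrite (eq_qform (N := fun a b => 1 * M a b + t * N a b)); last first.
  by move=> a b; rewrite mul1r.
rewrite qformDZ mul1r -[X in _ + X]opprK subr_ge0.
apply: le_trans (hM v); set S := \sum_a _.
have S0 : 0 <= S by rewrite sumr_ge0 // => a _; rewrite exprn_ge0.
apply: le_trans (_ : t * (K * S) <= _).
  rewrite -mulrN ler_wpM2l //; apply: le_trans (norm_qform_le _ _).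
  have := qform_real v hN; rewrite -realN -normrN; exact: real_ler_norm.
rewrite mulrA ler_wpM2r //.
apply: le_trans (_ : t * (K + 1) <= _); first by rewrite ler_wpM2l // lerDl.
by rewrite -ler_pdivlMr.
Qed.

End Kernels.

(** * Weyl-Heisenberg orbits *)

Section Weyl.
Variables (C : numClosedFieldType) (Z : finComNzRingType) (e : Z -> C).
Local Notation n := (#|Z|%:R : C).
Hypothesis eD : forall x y, e (x + y) = e x * e y.
Hypothesis eN : forall x, e (- x) = (e x)^*.
Hypothesis e_orth : forall x, \sum_k e (k * x) = n * (x == 0)%:R.
Implicit Types (M T : Z -> Z -> C) (lam gam : C).

Lemma card_ring_gt0 : 0 < n. Proof. by rewrite ltr0n; apply/card_gt0P; exists 0. Qed.
Let n0 : n != 0. Proof. exact: lt0r_neq0 card_ring_gt0. Qed.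

(** Multiplicativity alone would allow [e] to vanish identically; orthogonality at 0, where [n]
    copies of [e 0] add up to [n], excludes this. *)
Lemma e0 : e 0 = 1.
Proof.
apply: (mulfI n0); rewrite -[RHS]/(n * true%:R) -(eqxx (0 : Z)) -e_orth.
under eq_bigr do rewrite mulr0.
by rewrite sumr_const mulr_natl.
Qed.

(** Fourier inversion: weighting the [k]-th sum by [e (- (k * x))] and summing over [k] leaves
    [n * h x]. *)
Lemma fourier_inj (h : Z -> C) :
  (forall k, \sum_x e (k * x) * h x = 0) -> forall x, h x = 0.
Proof.
move=> hh x; apply: (mulfI n0); rewrite mulr0.
have : \sum_k e (- (k * x)) * (\sum_y e (k * y) * h y) = 0.
  by rewrite big1 // => k _; rewrite hh mulr0.
under eq_bigr do rewrite mulr_sumr; rewrite exchange_big /=.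
under eq_bigr => y _.
  under eq_bigr => k _ do rewrite mulrA -eD addrC -mulrBr.
  rewrite -mulr_suml e_orth subr_eq0; over.
rewrite (bigD1 x) //= big1 ?addr0 ?eqxx ?mulr1 // => y /negbTE ->.
by rewrite mulr0 mul0r.
Qed.

(** The Fourier transform of the correlation at [k] is the transform of [g] at [k] times that of [f]
    at [- k]. The latter factor never vanishes, so the former does. *)
Lemma correlation_inj (f g : Z -> C) :
    (forall y, \sum_b f b * e (y * b) != 0) ->
    (forall j, \sum_b g (b + j) * f b = 0) -> forall c, g c = 0.
Proof.
move=> hf hg; apply: fourier_inj => k; apply: (mulfI (hf (- k))); rewrite mulr0.
transitivity (\sum_j e (k * j) * \sum_b g (b + j) * f b); last first.
  by rewrite big1 // => j _; rewrite hg mulr0.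
under [RHS]eq_bigr do rewrite mulr_sumr; rewrite [RHS]exchange_big /= mulr_suml.
apply: eq_bigr => b _; rewrite (reindex_inj (addrI b)) /= mulr_sumr.
apply: eq_bigr => j _; rewrite mulrDr mulNr eD eN.
have : e (k * b) * (e (k * b))^* = 1 by rewrite -eN -eD subrr e0.
by move=> h; ring: h.
Qed.

(** The kernel of [W_jk T W_jk^*], the Weyl operator being [W_jk = U_j V_k]. *)
Definition orbit T (jk : Z * Z) : Z -> Z -> C :=
  fun a b => e (jk.2 * (a - b)) * T (a - jk.1) (b - jk.1).

Lemma psd_orbit T jk : psd T -> psd (orbit T jk).
Proof.
(* Up to a constant phase, [w] is the adjoint Weyl operator applied to [v]. *)
move=> hT v; pose w c := (e (jk.2 * (c + jk.1)))^* * v (c + jk.1).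
suff -> : qform (orbit T jk) v = qform T w by apply: hT.
rewrite /qform (reindex_inj (addIr jk.1)) /=; apply: eq_bigr => a _.
rewrite (reindex_inj (addIr jk.1)) /=; apply: eq_bigr => b _.
rewrite /orbit /w !addrK rmorphM /= conjCK opprD addrACA subrr addr0.
have -> : e (jk.2 * (a - b))
    = e (jk.2 * (a + jk.1)) * (e (jk.2 * (b + jk.1)))^*.
  by rewrite -eN -eD -mulrBr opprD addrACA subrr addr0.
by ring.
Qed.

(** Summing over [k] isolates, for each [x], the cross-correlation of the
    [x]-th off-diagonals of [D] and [T]; Fourier inversion finishes. *)
Lemma orbit_informationally_complete T (D : Z -> Z -> C) :
    (forall x y, \sum_b T (b + x) b * e (y * b) != 0) ->
    (forall jk, \sum_a \sum_b D a b * orbit T jk b a = 0) ->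
  forall a b, D a b = 0.
Proof.
move=> hT hD a b; rewrite -(subrKC a b).
move: (b - a) => x; move: a; apply: (correlation_inj (hT x)) => j.
move: x; apply: fourier_inj => k; rewrite -[RHS](hD (j, k)).
rewrite [RHS](reindex_inj (addIr j)) /=.
under eq_bigr do rewrite mulr_sumr.
rewrite exchange_big /=; apply: eq_bigr => c _.
rewrite [RHS](reindex_inj (addrI (c + j))) /=; apply: eq_bigr => x _.
rewrite /orbit /= [c + j + x - (c + j)]addrAC subrr add0r addrK [c + j + x]addrAC addrK.
by ring.
Qed.

(** * Margins of an orbit *)

Definition A_kernel lam (j a b : Z) : C :=
  (a == b)%:R * (lam * (a == j)%:R + (1 - lam) / n).

Definition B_kernel gam (k a b : Z) : C :=
  gam / n * e (k * (a - b)) + (1 - gam) / n * (a == b)%:R.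

(** The conditions on [T] under which its orbit has margins [A_lam] and [B_gam]. *)
Definition seed lam gam T : Prop :=
  (forall a, T a a = (lam * (a == 0)%:R + (1 - lam) / n) / n) /\
  (forall x, \sum_b T (b + x) b = (gam + (1 - gam) * (x == 0)%:R) / n).

(** Summing the phases over [k] kills the off-diagonal entries and leaves [n] times the diagonal of
    [T], translated by [j]. *)
Lemma seed_orbit_A lam gam T j a b : seed lam gam T ->
  \sum_k orbit T (j, k) a b = A_kernel lam j a b.
Proof.
move=> [hT _]; rewrite /orbit /= -mulr_suml e_orth /A_kernel subr_eq0.
have [<-|_] := eqVneq a b; last by rewrite mulr0 !mul0r.
rewrite hT subr_eq0; by field.
Qed.

(** Translating by all [j] sums [T] along its diagonal of offset [a - b], which is what the second
    seed condition prescribes. *)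
Lemma seed_orbit_B lam gam T k a b : seed lam gam T ->
  \sum_j orbit T (j, k) a b = B_kernel gam k a b.
Proof.
move=> [_ hT]; rewrite /orbit /= -mulr_sumr /B_kernel.
rewrite (reindex_inj (inj_comp (addrI b) oppr_inj)) /=.
under eq_bigr => c _.
  rewrite opprD opprK addrA addrA subrr add0r (addrC _ c); over.
rewrite hT subr_eq0; have [->|_] := eqVneq a b; last by rewrite mulr0n; ring.
by rewrite subrr mulr0 e0 mulr1n; field.
Qed.

(** * Twirling a joint observable *)

(** Each effect [M jk] is carried back to the origin by the inverse Weyl conjugation before
    averaging over the group. *)
Definition twirl (M : Z * Z -> Z -> Z -> C) : Z -> Z -> C :=
  fun a b => n ^- 2 * \sum_jk orbit (M jk) (- jk.1, - jk.2) a b.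

Lemma psd_twirl (M : Z * Z -> Z -> Z -> C) : (forall jk, psd (M jk)) -> psd (twirl M).
Proof.
move=> hM v; rewrite /qform /twirl.
have -> : \sum_a \sum_b (v a)^* *
    (n ^- 2 * (\sum_jk orbit (M jk) (- jk.1, - jk.2) a b)) * v b =
    n ^- 2 * \sum_jk qform (orbit (M jk) (- jk.1, - jk.2)) v.
  rewrite /qform [in RHS]exchange_big /= [in RHS]mulr_sumr; apply: eq_bigr => a _.
  rewrite [in RHS]exchange_big /= [in RHS]mulr_sumr; apply: eq_bigr => b _.
  rewrite mulrA [in LHS]mulr_sumr mulr_suml [RHS]mulr_sumr; apply: eq_bigr => jk _.
  by ring.
rewrite mulr_ge0 ?invr_ge0 ?exprn_ge0 ?sumr_ge0 // => jk _.
exact/psd_orbit/hM.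
Qed.

(** Both margins are themselves covariant, so after moving back to the origin every outcome
    contributes the same amount to the average. *)
Lemma seed_twirl lam gam (M : Z * Z -> Z -> Z -> C) :
    (forall j a b, \sum_k M (j, k) a b = A_kernel lam j a b) ->
    (forall k a b, \sum_j M (j, k) a b = B_kernel gam k a b) ->
  seed lam gam (twirl M).
Proof.
move=> hA hB; split=> [a|x]; rewrite /twirl /orbit.
  transitivity (n ^- 2 * \sum_j \sum_k M (j, k) (a + j) (a + j)).
    rewrite pair_bigA; congr (_ * _); apply: eq_bigr => -[j k] _ /=.
    by rewrite subrr mulr0 e0 mul1r opprK.
  under eq_bigr => j _ do
    rewrite hA /A_kernel eqxx mulr1n mul1r -subr_eq0 addrK.
  by rewrite sumr_const -mulr_natr; field.
transitivity (n ^- 2 * \sum_k e (- (k * x)) * \sum_c \sum_j M (j, k) (c + x) c).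
  rewrite -mulr_sumr exchange_big /=; congr (_ * _).
  transitivity (\sum_j \sum_k \sum_b orbit (M (j, k)) (- j, - k) (b + x) b).
    by rewrite [RHS]pair_bigA; apply: eq_bigr => -[].
  rewrite exchange_big /=; apply: eq_bigr => k _.
  rewrite [in RHS]exchange_big mulr_sumr; apply: eq_bigr => j _ /=.
  rewrite [in RHS](reindex_inj (addIr j)) [in RHS]mulr_sumr; apply: eq_bigr => b _ /=.
  by rewrite /orbit /= !opprK [b + x - b]addrAC subrr add0r mulNr [b + j + x]addrAC.
have -> : \sum_k e (- (k * x)) * \sum_c \sum_j M (j, k) (c + x) c =
    \sum_(k : Z) (gam + (1 - gam) * (x == 0)%:R).
  apply: eq_bigr => k _; under eq_bigr => c _.
    rewrite hB /B_kernel addrAC subrr add0r -subr_eq0 addrAC subrr add0r; over.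
  rewrite sumr_const -mulr_natr.
  have [->|_] := eqVneq x 0; first by rewrite mulr0 oppr0 e0 mulr1n; field.
  (* The twirling phase cancels the phase of [B_kernel], making the summand independent of [k]. *)
  have : e (k * x) * e (- (k * x)) = 1 by rewrite -eD subrr e0.
  by rewrite mulr0n => h; field: h.
by rewrite sumr_const -mulr_natr; field.
Qed.

(** * Strictly positive seeds and their perturbation *)

Lemma seed_scale lam gam T t :
    0 <= t <= 1 -> 0 <= lam -> psd T -> seed lam gam T ->
  exists2 S, seed lam (t * gam) S &
    forall v, (1 - t) * ((1 - lam) / n / n) * \sum_a `|v a| ^+ 2 <= qform S v.
Proof.
move=> /andP[t0 t1] l0 hT [hA hB].
(* The diagonal summand is a seed for [lam] and 0; its entries are at least [(1 - lam) / n / n],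
   which gives the lower bound on the form. *)
pose T0 a b := t * T a b
  + (1 - t) * ((a == b)%:R * ((lam * (a == 0)%:R + (1 - lam) / n) / n)).
exists T0.
  split=> [a|x]; first by rewrite /T0 hA eqxx mulr1n; field.
  rewrite big_split /= -!mulr_sumr hB.
  under [X in _ + _ * X]eq_bigr => b _ do rewrite -subr_eq0 addrAC subrr add0r.
  have [->|_] := eqVneq x 0; last first.
    by rewrite mulr0n big1 => [|b _]; [field | rewrite mul0r].
  under eq_bigr do rewrite mulr1n mul1r addr0.
  have -> : \sum_(i : Z) (lam * (i == 0)%:R + (1 - lam) / n) / n = 1 / n.
    rewrite -mulr_suml big_split /= sumr_const -mulr_sumr -mulr_natr.
    rewrite (bigD1 0) //= eqxx big1 ?addr0; last by move=> i /negbTE ->.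
    by rewrite mulr1n; field.
  by rewrite mulr1n; field.
move=> v; rewrite qformDZ qform_diag.
apply: le_trans (_ : _ <= (1 - t) *
  \sum_(a : Z) (lam * (a == 0)%:R + (1 - lam) / n) / n * `|v a| ^+ 2) _; last first.
  by rewrite lerDr mulr_ge0.
rewrite -mulrA ler_wpM2l ?subr_ge0 // mulr_sumr; apply: ler_sum => a _.
apply: ler_wpM2r; first by rewrite exprn_ge0.
apply: ler_wpM2r; first by rewrite invr_ge0 ltW ?card_ring_gt0.
by rewrite lerDr mulr_ge0 ?ler0n.
Qed.

(** Hermitian, and invisible to both margins: the coefficients computed in
    [bump_fourier] vanish at [y = 0], and the diagonal is zero. *)
Definition bump (z : C) (a b : Z) : C :=
  (a != b)%:R * (z * (b == 0)%:R + z^* * (a == 0)%:R - (z + z^*) / n).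

Lemma bump_diag z a : bump z a a = 0.
Proof. by rewrite /bump eqxx mul0r. Qed.

Lemma bump_conj z a b : bump z b a = (bump z a b)^*.
Proof.
rewrite /bump rmorphM rmorphB rmorphD !rmorphM /= fmorphV !conjC_nat rmorphD /=.
by rewrite conjCK rmorph_nat [b == a]eq_sym; ring.
Qed.

(** On the diagonal of offset [x], the bump consists of [z] at [b = 0], its conjugate at [b = - x],
    and a constant whose transform is concentrated at [y = 0]. *)
Lemma bump_fourier z x y : x != 0 ->
  \sum_b bump z (b + x) b * e (y * b) =
  (z + z^* * e (- (y * x))) - (z + z^*) * (y == 0)%:R.
Proof.
move=> x0.
have -> : \sum_b bump z (b + x) b * e (y * b) =
    z * (\sum_(b : Z) (b == 0)%:R * e (y * b))
    + z^* * (\sum_(b : Z) (b == - x)%:R * e (y * b))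
    - (z + z^*) / n * \sum_b e (b * y).
  rewrite !mulr_sumr -sumrN -!big_split; apply: eq_bigr => b _ /=.
  rewrite /bump -subr_eq0 [b + x - b]addrAC subrr add0r x0 addr_eq0 [b * y]mulrC.
  by rewrite mulr1n; ring.
have sum_delta c : \sum_(b : Z) (b == c)%:R * e (y * b) = e (y * c).
  rewrite (bigD1 c) //= big1 ?eqxx ?mul1r ?addr0 // => b /negbTE ->.
  by rewrite mul0r.
by rewrite !sum_delta e_orth mulr0 e0 mulrN; field.
Qed.

Lemma exists_nonvanishing_bump : exists z,
  forall x y, x != 0 -> y != 0 -> \sum_b bump z (b + x) b * e (y * b) != 0.
Proof.
(* With [z = 1 + t * 'i] and [t] real, [z + z^* * e w] equals [(1 + e w) + t * ('i * (1 - e w))],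
   and the two coefficients cannot both vanish. Every [w] is covered, including 0, which [y * x] may
   hit through zero divisors. *)
have [w|t [t0 _ ht]] := @affine_nonvanishing C Z
  (fun w => 1 + e w) (fun w => 'i * (1 - e w)) 1 ltr01.
  have [h|//] := eqVneq (1 + e w) 0; rewrite mulf_neq0 ?neq0Ci //.
  rewrite subr_eq0; apply/eqP => h1; move: h; rewrite -h1 => /eqP.
  by rewrite (_ : 1 + 1 = 2%:R) // pnatr_eq0.
exists (1 + t * 'i) => x y x0 y0; rewrite bump_fourier // (negbTE y0) mulr0 subr0.
have := ht (- (y * x)); apply: contra_neq => <-.
rewrite rmorphD rmorphM rmorph1 /= conjCi (CrealP _) ?gtr0_real //.
by ring.
Qed.

(** The coefficient is [gam / n] for [y = 0] and nonzero [x], [lam / n] for [x = 0] and nonzero [y],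
    and [1 / n] at the origin. *)
Lemma seed_fourier_margin lam gam T x y :
    0 < lam -> 0 < gam -> seed lam gam T -> (x == 0) || (y == 0) ->
  \sum_b T (b + x) b * e (y * b) != 0.
Proof.
move=> l0 g0 [hA hB]; have [->|x0 /=] := eqVneq x 0; last first.
  move=> /eqP ->; under eq_bigr do rewrite mul0r e0 mulr1.
  by rewrite hB (negbTE x0) mulr0 addr0 mulf_neq0 ?invr_eq0 ?n0 ?lt0r_neq0.
move=> _; under eq_bigr do rewrite addr0 hA.
have -> : \sum_(b : Z) (lam * (b == 0)%:R + (1 - lam) / n) / n * e (y * b) =
    lam / n * (\sum_(b : Z) (b == 0)%:R * e (y * b))
    + (1 - lam) / n / n * \sum_b e (b * y).
  rewrite !mulr_sumr -!big_split; apply: eq_bigr => b _ /=.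
  by rewrite (mulrC b); field.
rewrite (bigD1 0) //= big1 => [|b /negbTE ->]; last by rewrite mul0r.
rewrite eqxx mulr0 e0 addr0 mulr1 mulr1n e_orth.
have [_|_] := eqVneq y 0; last first.
  by rewrite mulr0n !mulr0 addr0 mulr1 mulf_neq0 ?invr_eq0 ?n0 ?lt0r_neq0.
rewrite (_ : _ + _ = n^-1) ?invr_eq0 //.
by rewrite mulr1n; field.
Qed.

Lemma exists_seed lam gam gam_max T :
    0 < lam -> lam < 1 -> 0 < gam -> gam < gam_max ->
    psd T -> seed lam gam_max T ->
  exists S, [/\ psd S, seed lam gam S &
    forall x y, \sum_b S (b + x) b * e (y * b) != 0].
Proof.
move=> l0 l1 g0 gm hT sT; have gm0 := lt_trans g0 gm.
have t0 : 0 < gam / gam_max by rewrite divr_gt0.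
have t1 : gam / gam_max < 1 by rewrite ltr_pdivrMr ?mul1r.
have [||S] := seed_scale (t := gam / gam_max) _ _ hT sT.
- by rewrite !ltW.
- exact: ltW.
rewrite divfK ?lt0r_neq0 // => sS hS.
have [z hz] := exists_nonvanishing_bump.
have c0 : 0 < (1 - gam / gam_max) * ((1 - lam) / n / n).
  by rewrite mulr_gt0 ?divr_gt0 ?subr_gt0 ?card_ring_gt0.
have [eps eps0 heps] := psd_perturb c0 hS (bump_conj z).
(* Indexing by all pairs yields one [t] for which no coefficient of [S + t * bump z] vanishes. *)
pose p (xy : Z * Z) := \sum_b S (b + xy.1) b * e (xy.2 * b).
pose q (xy : Z * Z) := \sum_b bump z (b + xy.1) b * e (xy.2 * b).
have [[x y]|t [t_gt0 t_le ht]] := affine_nonvanishing (p := p) (q := q) eps0.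
  have [xy0|] := boolP ((x == 0) || (y == 0)).
    by rewrite /p (seed_fourier_margin l0 g0 sS xy0).
  by rewrite negb_or => /andP[x0 y0]; rewrite /q hz ?orbT.
have [sA sB] := sS.
exists (fun a b => S a b + t * bump z a b); split.
- exact: heps (ltW t_gt0) t_le.
- split=> [a|x]; first by rewrite bump_diag mulr0 addr0.
  rewrite big_split /= sB -mulr_sumr [X in t * X](_ : _ = 0) ?mulr0 ?addr0 //.
  have [->|x0] := eqVneq x 0.
    by rewrite big1 // => b _; rewrite addr0 bump_diag.
  (* A plain sum along a diagonal is the coefficient at [y = 0]. *)
  transitivity (\sum_b bump z (b + x) b * e (0 * b)).
    by apply: eq_bigr => b _; rewrite mul0r e0 mulr1.
  by rewrite bump_fourier // eqxx mul0r oppr0 e0 !mulr1 subrr.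
- move=> x y; have := ht (x, y); congr (_ != 0).
  rewrite /p /q /= mulr_sumr -big_split; apply: eq_bigr => b _ /=.
  by ring.
Qed.
End Weyl.

(** * The characters of Z/dZ *)

Section RootOfUnity.
Variables (R : realType) (d : nat).
Hypothesis hd : (2 <= d)%N.
Local Notation w := (@omega R d).

Lemma omega_expr m :
  w ^+ m = (cos (m%:R * (2 * pi / d%:R)) +i* sin (m%:R * (2 * pi / d%:R)))%C.
Proof.
elim: m => [|m IH]; first by rewrite expr0 !mul0r cos0 sin0.
rewrite exprS IH /omega; set t := 2 * pi / _; set u := m%:R * t.
have -> : m.+1%:R * t = t + u by rewrite -nat1r mulrDl mul1r.
rewrite cosD sinD; apply/eqP; rewrite eq_complex /= eqxx.
by rewrite [sin t * _ + _]addrC eqxx.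
Qed.

Lemma omega_expr_d : w ^+ d = 1.
Proof.
rewrite omega_expr mulrC divfK ?pnatr_eq0 -?lt0n ?(ltnW hd) //.
by rewrite mulrC mulr_natr cos2pi sin2pi.
Qed.

(** If the real part, the cosine of twice the angle [m * pi / d], were 1, the sine of that angle
    would vanish, although it lies strictly between 0 and [pi]. *)
Lemma omega_expr_neq1 m : (0 < m < d)%N -> w ^+ m != 1.
Proof.
move=> /andP[m0 md]; rewrite omega_expr eq_complex /= negb_and.
have d0 : (0 : R) < d%:R by rewrite ltr0n (ltnW hd).
set t := _ * (2 * pi / _); have -> : t = (m%:R / d%:R * pi) *+ 2.
  by rewrite /t -mulr_natr; field; rewrite lt0r_neq0.
have s0 : 0 < sin (m%:R / d%:R * pi : R).
  apply: sin_gt0_pi; apply/andP; split.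
    by rewrite !mulr_gt0 ?invr_gt0 ?pi_gt0 ?d0 ?ltr0n.
  by rewrite gtr_pMl ?pi_gt0 // ltr_pdivrMr // mul1r ltr_nat.
rewrite cos_mulr2n.
apply/orP; left; apply/eqP => h; have h2 := cos2Dsin2 (m%:R / d%:R * pi : R).
have : sin (m%:R / d%:R * pi : R) ^+ 2 = 0 by lra.
by move/eqP; rewrite sqrf_eq0 gt_eqF.
Qed.

Lemma norm_omega : `|w| = 1.
Proof.
by apply/eqP; rewrite -(@pexpr_eq1 _ _ d) ?(ltnW hd) // -normrX omega_expr_d normr1.
Qed.

Definition chi (x : 'Z_d) : R[i] := w ^+ x.

Lemma chi_nat m : chi m%:R = w ^+ m.
Proof. by rewrite /chi val_Zp_nat // (expr_mod _ omega_expr_d). Qed.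

(** Links the product modulo [d] with the natural-number exponents in [fourier] and [phase_op]. *)
Lemma chi_mul (x y : 'Z_d) : chi (x * y) = w ^+ (x * y)%N.
Proof. by rewrite -chi_nat natrM !natr_Zp. Qed.

Lemma chiD (x y : 'Z_d) : chi (x + y) = chi x * chi y.
Proof. by rewrite -exprD -chi_nat natrD !natr_Zp. Qed.

Lemma chiN (x : 'Z_d) : chi (- x) = Num.conj (chi x).
Proof.
have nx : `|chi x| = 1 by rewrite normrX norm_omega expr1n.
have x0 : chi x != 0 by rewrite -normr_gt0 nx.
apply: (mulfI x0); rewrite -chiD subrr -normCK nx expr1n.
by rewrite /chi expr0.
Qed.

Lemma card_Zd : #|'Z_d| = d.
Proof. by rewrite card_ord Zp_cast. Qed.

(** Shifting [k] by 1 multiplies the sum by [chi x], which differs from 1 when [x] is nonzero. *)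
Lemma chi_orth (x : 'Z_d) :
  \sum_(k : 'Z_d) chi (k * x) = #|'Z_d|%:R * (x == 0)%:R.
Proof.
have [->|x0] := eqVneq x 0.
  under eq_bigr do rewrite mulr0 /chi expr0.
  by rewrite sumr_const mulr1.
rewrite mulr0n mulr0; have x1 : chi x != 1.
  apply: omega_expr_neq1; rewrite lt0n x0 /=.
  by have := ltn_ord x; rewrite {2}(Zp_cast hd).
have /eqP : (chi x - 1) * \sum_(k : 'Z_d) chi (k * x) = 0.
  rewrite mulrBl mul1r mulr_sumr [X in _ - X](reindex_inj (addrI 1)) /=.
  apply/eqP; rewrite subr_eq0; apply/eqP; apply: eq_bigr => k _.
  by rewrite -chiD mulrDl mul1r.
by rewrite mulf_eq0 subr_eq0 (negbTE x1) => /eqP.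
Qed.

End RootOfUnity.

(** * Operators and their kernels *)

Import passmx.

Section Operators.
Variables (R : realType) (d : nat) (H : vectType R[i]) (ip : {dot H for Num.conj}).
Variable phi : 'Z_d -> H.
Hypothesis hd : (2 <= d)%N.
Hypothesis hphi : orthonormal_basis ip phi.
Implicit Types (F G T : 'End(H)) (M S : 'Z_d -> 'Z_d -> R[i]) (v : H).

Definition kernel_of T (a b : 'Z_d) : R[i] := braket ip (phi a) (T (phi b)).

Definition op_of M : 'End(H) :=
  \sum_a \sum_b M a b *: ketbra ip (phi a) (phi b).

Lemma braketDr u v w : braket ip u (v + w) = braket ip u v + braket ip u w.
Proof. exact: linearDl. Qed.

Lemma braketZr u c v : braket ip u (c *: v) = c * braket ip u v.
Proof. exact: linearZl_LR. Qed.

Lemma braket_sumr I r (P : pred I) u (f : I -> H) :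
  braket ip u (\sum_(i <- r | P i) f i) = \sum_(i <- r | P i) braket ip u (f i).
Proof. exact: linear_sumlz. Qed.

Lemma braketC u v : braket ip u v = Num.conj (braket ip v u).
Proof. by rewrite /braket hermC expr0 mul1r. Qed.

Lemma kernel_sum I r (P : pred I) (f : I -> 'End(H)) a b :
  kernel_of (\sum_(i <- r | P i) f i) a b
  = \sum_(i <- r | P i) kernel_of (f i) a b.
Proof. by rewrite /kernel_of sum_lfunE braket_sumr. Qed.

Lemma kernelD F G a b : kernel_of (F + G) a b = kernel_of F a b + kernel_of G a b.
Proof. by rewrite /kernel_of add_lfunE braketDr. Qed.

Lemma kernelZ c F a b : kernel_of (c *: F) a b = c * kernel_of F a b.
Proof. by rewrite /kernel_of scale_lfunE braketZr. Qed.

Lemma kernel1 a b : kernel_of \1%VF a b = (a == b)%:R.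
Proof. by rewrite /kernel_of id_lfunE orthonormal_basisE. Qed.

Lemma kernel_ketbra u v a b : kernel_of (ketbra ip u v) a b
  = braket ip (phi a) u * Num.conj (braket ip (phi b) v).
Proof. by rewrite /kernel_of ketbraE braketZr mulrC [X in _ * X]braketC. Qed.

Lemma kernelK F : op_of (kernel_of F) = F.
Proof.
apply/lfunP => v; rewrite [in RHS](basis_expansion v hphi) linear_sum.
rewrite sum_lfunE; under eq_bigr do rewrite sum_lfunE.
rewrite exchange_big; apply: eq_bigr => b _ /=.
rewrite linearZ /= [F (phi b)](basis_expansion _ hphi) scaler_sumr.
apply: eq_bigr => a _; rewrite scale_lfunE ketbraE !scalerA mulrC.
by [].
Qed.

Lemma op_ofK M a b : kernel_of (op_of M) a b = M a b.
Proof.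
rewrite kernel_sum (bigD1 a) //= [X in _ + X]big1 => [|i ia]; last first.
  rewrite kernel_sum big1 // => j _; rewrite kernelZ kernel_ketbra.
  by rewrite orthonormal_basisE // eq_sym (negbTE ia) mul0r mulr0.
rewrite addr0 kernel_sum (bigD1 b) //= big1 => [|j jb]; last first.
  rewrite kernelZ kernel_ketbra [X in Num.conj X]orthonormal_basisE //.
  by rewrite eq_sym (negbTE jb) conjC0 !mulr0.
by rewrite kernelZ kernel_ketbra !orthonormal_basisE // !eqxx conjC1 !mulr1 addr0.
Qed.

Lemma kernel_inj F G :
  (forall a b, kernel_of F a b = kernel_of G a b) -> F = G.
Proof.
move=> h; rewrite -[F]kernelK -[G]kernelK; apply: eq_bigr => a _.
by apply: eq_bigr => b _; rewrite h.
Qed.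

Lemma kernel_comp F G a b :
  kernel_of (F \o G)%VF a b = \sum_c kernel_of F a c * kernel_of G c b.
Proof.
have -> : kernel_of (F \o G)%VF a b
    = braket ip (phi a) (F (\sum_c kernel_of G c b *: phi c)).
  by rewrite /kernel_of comp_lfunE -basis_expansion.
rewrite linear_sum braket_sumr; apply: eq_bigr => c _.
by rewrite linearZ /= braketZr mulrC.
Qed.

Lemma kernel_adjoint F a b :
  kernel_of (adjoint ip F) a b = Num.conj (kernel_of F b a).
Proof.
rewrite /kernel_of braketC; congr (Num.conj _).
by rewrite (adjointP F hphi).
Qed.

Lemma braket_qform F v :
  braket ip v (F v) = qform (kernel_of F) (fun a => braket ip (phi a) v).
Proof.
have -> : F v = \sum_b braket ip (phi b) v *: F (phi b).
  rewrite {1}(basis_expansion v hphi) linear_sum.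
  by apply: eq_bigr => b _; rewrite linearZ.
have bl u : braket ip v u
    = \sum_a Num.conj (braket ip (phi a) v) * braket ip (phi a) u.
  rewrite braketC [X in braket ip u X](basis_expansion v hphi) braket_sumr.
  rewrite rmorph_sum; apply: eq_bigr => a _.
  by rewrite braketZr rmorphM /= [braket ip (phi a) u]braketC.
rewrite bl; apply: eq_bigr => a _.
rewrite braket_sumr mulr_sumr; apply: eq_bigr => b _.
by rewrite braketZr mulrA mulrAC.
Qed.

Lemma positive_opP F : positive_op ip F <-> psd (kernel_of F).
Proof.
split=> [hF v|hF v]; last by rewrite braket_qform; apply: hF.
pose u := \sum_b v b *: phi b.
have := hF u; rewrite braket_qform.
suff hu a : braket ip (phi a) u = v a.
  by congr (0 <= _); do 2![apply: eq_bigr => ? _]; rewrite !hu.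
rewrite braket_sumr (bigD1 a) //= big1 => [|b ba].
  by rewrite braketZr orthonormal_basisE // eqxx mulr1 addr0.
by rewrite braketZr orthonormal_basisE // eq_sym (negbTE ba) mulr0.
Qed.

Lemma optrace_comp F G : optrace (F \o G)%VF = optrace (G \o F)%VF.
Proof.
by rewrite /optrace !(passmx.mxof_comp _ _ (vbasisP _)) mxtrace_mulC.
Qed.

Lemma optrace_sum I r (P : pred I) (f : I -> 'End(H)) :
  optrace (\sum_(i <- r | P i) f i) = \sum_(i <- r | P i) optrace (f i).
Proof. by rewrite /optrace !linear_sum. Qed.

Lemma optraceZ c F : optrace (c *: F) = c * optrace F.
Proof. by rewrite /optrace !linearZ. Qed.

Lemma optrace1 : optrace (\1%VF : 'End(H)) = (\dim {:H})%:R.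
Proof. by rewrite /optrace passmx.mxof1 ?(basis_free (vbasisP _)) // mxtrace1. Qed.

Local Notation E a b := (ketbra ip (phi a) (phi b)).

Lemma comp_ketbra (a b c k : 'Z_d) :
  (E a b \o E c k)%VF = (b == c)%:R *: E a k.
Proof.
apply/lfunP => v; rewrite comp_lfunE scale_lfunE !ketbraE braketZr.
by rewrite orthonormal_basisE // scalerA mulrC.
Qed.

Lemma sum_ketbra : \sum_a E a a = \1%VF.
Proof.
apply/lfunP => v; rewrite sum_lfunE id_lfunE [RHS](basis_expansion v hphi).
by apply: eq_bigr => a _; rewrite ketbraE.
Qed.

Lemma dimH : \dim {:H} = d.
Proof.
have [_ bphi] := hphi.
by rewrite -(span_basis bphi) (eqnP (basis_free bphi)) size_codom card_Zd.
Qed.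

(** No change of basis is computed: cyclicity makes the traces of the matrix units a multiple [t] of
    the Kronecker delta, and the trace of the identity fixes [t = 1]. *)
Lemma optraceE F : optrace F = \sum_a kernel_of F a a.
Proof.
pose t := optrace (E 0 0).
have tE a b : optrace (E a b) = (a == b)%:R * t.
  have -> : E a b = (E a 0 \o E 0 b)%VF by rewrite comp_ketbra eqxx scale1r.
  by rewrite optrace_comp comp_ketbra optraceZ eq_sym.
have t1 : t = 1.
  have d0 : (d%:R : R[i]) != 0 by rewrite pnatr_eq0 -lt0n (ltnW hd).
  apply: (mulfI d0); rewrite mulr1 -{2}dimH -optrace1 -sum_ketbra optrace_sum.
  under eq_bigr do rewrite tE eqxx mul1r.
  by rewrite sumr_const card_Zd // mulr_natl.
rewrite -{1}[F]kernelK optrace_sum; apply: eq_bigr => a _.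
rewrite optrace_sum (bigD1 a) //= big1 => [|b ba].
  by rewrite optraceZ tE eqxx t1 !mulr1 addr0.
by rewrite optraceZ tE eq_sym (negbTE ba) mul0r mulr0.
Qed.

(** * Kernels of the noisy observables and of the Weyl operators *)

Local Notation e := (@chi R d).
Let eD : forall x y, e (x + y) = e x * e y := chiD R hd.
Let eN : forall x, e (- x) = Num.conj (e x) := chiN R hd.
Let e_orth : forall x, \sum_k e (k * x) = #|{: 'Z_d}|%:R * (x == 0)%:R :=
  chi_orth R hd.

Lemma kernel_smear t T a b : kernel_of (smear d t T) a b =
  t%:C%C * kernel_of T a b + (1 - t%:C%C) / d%:R * (a == b)%:R.
Proof.
by rewrite kernelD !kernelZ kernel1 mulrA rmorphB rmorph1.
Qed.

Lemma kernel_A t j a b :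
  kernel_of (A_ ip phi t j) a b = A_kernel (t%:C%C) j a b.
Proof.
rewrite kernel_smear kernel_ketbra !orthonormal_basisE // conjC_nat.
rewrite /A_kernel card_Zd //.
have [<-|ab] := eqVneq a b.
  by case: (a == j); rewrite /= ?mulr0n ?mulr1n; ring.
have [aj|_] := eqVneq a j; last by rewrite !mulr0n; ring.
by rewrite -aj [b == a]eq_sym (negbTE ab) !mulr0n; ring.
Qed.

Lemma braket_fourier a k : braket ip (phi a) (fourier phi k) =
  ((Num.sqrt d%:R)^-1 : R)%:C%C * e (k * a).
Proof.
rewrite braketZr braket_sumr (bigD1 a) //= big1 => [|b ba]; last first.
  by rewrite braketZr orthonormal_basisE // eq_sym (negbTE ba) mulr0.
by rewrite braketZr orthonormal_basisE // eqxx mulr1 addr0 mulnC chi_mul.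
Qed.

Lemma kernel_B t k a b :
  kernel_of (B_ ip phi t k) a b = B_kernel e (t%:C%C) k a b.
Proof.
rewrite kernel_smear kernel_ketbra !braket_fourier rmorphM /= -eN.
rewrite /B_kernel card_Zd // mulrBr eD.
set s := (Num.sqrt d%:R)^-1%:C%C.
have -> : Num.conj s = s by apply: CrealP; rewrite ger0_real // ler0c invr_ge0 sqrtr_ge0.
have ss : s * s = d%:R^-1.
  rewrite /s -rmorphM -invfM -expr2 sqr_sqrtr ?ler0n //.
  by rewrite fmorphV rmorph_nat.
by ring: ss.
Qed.

Lemma kernel_shift_comp x F a b :
  kernel_of (shift_op ip phi x \o F)%VF a b = kernel_of F (a - x) b.
Proof.
rewrite kernel_comp (bigD1 (a - x)) //= big1 => [|c ca].
  by rewrite /kernel_of shift_opE // subrK orthonormal_basisE // eqxx mul1r addr0.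
rewrite {1}/kernel_of shift_opE // orthonormal_basisE //.
by rewrite -subr_eq eq_sym (negbTE ca) mul0r.
Qed.

Lemma kernel_comp_adjoint_shift x F a b :
  kernel_of (F \o adjoint ip (shift_op ip phi x))%VF a b = kernel_of F a (b - x).
Proof.
rewrite kernel_comp (bigD1 (b - x)) //= big1 => [|c cb].
  rewrite kernel_adjoint {2}/kernel_of shift_opE // subrK.
  by rewrite orthonormal_basisE // eqxx conjC1 mulr1 addr0.
rewrite kernel_adjoint {2}/kernel_of shift_opE // orthonormal_basisE //.
by rewrite -subr_eq eq_sym (negbTE cb) conjC0 mulr0.
Qed.

Lemma kernel_phase y a b :
  kernel_of (phase_op ip phi y) a b = e (y * b) * (a == b)%:R.
Proof.
by rewrite /kernel_of phase_opE // braketZr orthonormal_basisE // chi_mul.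
Qed.

Lemma kernel_phase_comp y F a b :
  kernel_of (phase_op ip phi y \o F)%VF a b = e (y * a) * kernel_of F a b.
Proof.
rewrite kernel_comp (bigD1 a) //= big1 => [|c ca]; rewrite kernel_phase.
  by rewrite eqxx mulr1 addr0.
by rewrite eq_sym (negbTE ca) mulr0 mul0r.
Qed.

Lemma kernel_comp_adjoint_phase y F a b :
  kernel_of (F \o adjoint ip (phase_op ip phi y))%VF a b
  = kernel_of F a b * e (- (y * b)).
Proof.
rewrite kernel_comp (bigD1 b) //= big1 => [|c cb].
  by rewrite kernel_adjoint kernel_phase eqxx mulr1 addr0 eN.
by rewrite kernel_adjoint kernel_phase eq_sym (negbTE cb) mulr0 conjC0 mulr0.
Qed.

(** * Phase space observables generated by seeds *)

Definition phase_space_observable S (jk : 'Z_d * 'Z_d) : 'End(H) :=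
  op_of (orbit e S jk).

Lemma joint_phase_space_observable (lam gam : R) S :
    psd S -> seed (lam%:C%C) (gam%:C%C) S ->
  joint_observable ip (A_ ip phi lam) (B_ ip phi gam)
    (phase_space_observable S).
Proof.
move=> hT sT.
have hA j : \sum_k phase_space_observable S (j, k) = A_ ip phi lam j.
  apply: kernel_inj => a b; rewrite kernel_sum kernel_A.
  by under eq_bigr do rewrite op_ofK; exact: (seed_orbit_A e_orth _ _ _ sT).
have hB k : \sum_j phase_space_observable S (j, k) = B_ ip phi gam k.
  apply: kernel_inj => a b; rewrite kernel_sum kernel_B.
  by under eq_bigr do rewrite op_ofK; exact: (seed_orbit_B e_orth _ _ _ sT).
split=> //; split=> [jk|].
  apply/positive_opP => v; rewrite (eq_qform (N := orbit e S jk)).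
    exact: (psd_orbit eD eN).
  exact: op_ofK.
(* Normalisation follows from the first margin, since the effects [A_ ip phi lam j] sum to the
   identity. *)
rewrite -(eq_bigr _ (fun jk _ => congr1 _ (esym (surjective_pairing jk)))).
rewrite -(pair_bigA _ (fun j k => phase_space_observable S (j, k))) /=.
under eq_bigr do rewrite hA.
apply: kernel_inj => a b; rewrite kernel_sum kernel1.
under eq_bigr do rewrite kernel_A /A_kernel.
rewrite -mulr_sumr big_split /= -mulr_sumr sumr_const -[_ *+ #|_|]mulr_natr.
rewrite (bigD1 a) //= big1 => [|j ja]; last by rewrite eq_sym (negbTE ja).
rewrite eqxx mulr1n addr0 mulr1 divfK; first by rewrite addrC subrK mulr1.
by rewrite card_Zd // pnatr_eq0 -lt0n (ltnW hd).
Qed.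

Lemma phase_space_observable_covariant S :
  observable ip (phase_space_observable S) ->
  covariant_phase_space_observable ip phi (phase_space_observable S).
Proof.
move=> hobs; split=> // j k x y; apply: kernel_inj => a b.
rewrite kernel_comp_adjoint_shift kernel_comp_adjoint_phase.
rewrite -comp_lfunA kernel_shift_comp kernel_phase_comp !op_ofK /orbit /=.
have -> : a - x - (b - x) = a - b by rewrite opprB addrA subrK.
have -> : e ((k + y) * (a - b))
    = e (k * (a - b)) * (e (y * (a - x)) * e (- (y * (b - x)))).
  by rewrite mulrDl eD -[in RHS]eD -mulrBr opprB addrA subrK.
rewrite !opprD !addrA ![_ - j - x]addrAC.
by ring.
Qed.

Lemma phase_space_observable_complete S :
    (forall x y, \sum_b S (b + x) b * e (y * b) != 0) ->
  informationally_complete ip (phase_space_observable S).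
Proof.
move=> hT rho1 rho2 _ _ h; apply: kernel_inj => a b; apply/eqP.
rewrite -subr_eq0; apply/eqP; move: a b.
apply: (orbit_informationally_complete eD eN e_orth hT) => jk.
(* Equal statistics mean that the kernel of [rho1 - rho2] has zero trace pairing with every kernel
   of the orbit. *)
have := h jk; rewrite !optraceE => /eqP; rewrite -subr_eq0 -sumrB => /eqP h0.
rewrite -[RHS]h0.
apply: eq_bigr => a _; rewrite !kernel_comp -sumrB; apply: eq_bigr => b _.
by rewrite op_ofK mulrBl.
Qed.

Lemma seed_of_jointly_measurable (lam gam : R) :
    jointly_measurable ip (A_ ip phi lam) (B_ ip phi gam) ->
  exists2 S : 'Z_d -> 'Z_d -> R[i],
    psd S & seed (lam%:C%C) (gam%:C%C) S.
Proof.
move=> [D [[hpos _] hA hB]].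
exists (twirl e (fun jk => kernel_of (D jk))).
  by apply: (psd_twirl eD eN) => jk; apply/positive_opP.
by apply: (seed_twirl eD e_orth) => [j|k] a b;
  rewrite -?kernel_A -?kernel_B -kernel_sum ?hA ?hB.
Qed.

End Operators.

Local Open Scope complex_scope.

Theorem proposition10 (R : realType) (d : nat) (hd : (2 <= d)%N)
    (H : vectType R[i]) (hH : \dim {:H} = d) (ip : {dot H for Num.conj})
    (phi : 'Z_d -> H) (hphi : orthonormal_basis ip phi)
    (lambda gamma gamma_max : R)
    (hlambda : 0 <= lambda <= 1)
    (hlambda0 : lambda != 0) (hlambda1 : lambda != 1)
    (hmax : is_gamma_max ip phi lambda gamma_max)
    (hgamma : 0 < gamma < gamma_max) :
  exists C : 'Z_d * 'Z_d -> 'End(H),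
    [/\ joint_observable ip (A_ ip phi lambda) (B_ ip phi gamma) C,
        informationally_complete ip C
      & covariant_phase_space_observable ip phi C].
Proof.
have /andP[l0 l1] := hlambda; have /andP[g0 gm] := hgamma.
have [_ hJ _] := hmax.
(* The maximum is attained, so there is a seed at [gamma_max] itself to start from. *)
have [T hT sT] := seed_of_jointly_measurable hd hphi hJ.
have [||||S [hS sS fS]] :=
  exists_seed (chi_orth R hd) (lam := lambda%:C)
    (gam := gamma%:C) _ _ _ _ hT sT.
- by rewrite ltcR lt_neqAle eq_sym hlambda0.
- by rewrite ltcR lt_neqAle hlambda1.
- by rewrite ltcR.
- by rewrite ltcR.
have hC := joint_phase_space_observable hd hphi hS sS.
exists (phase_space_observable ip phi S); split=> //.
  exact: phase_space_observable_complete.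
by apply: phase_space_observable_covariant => //; case: hC.
Qed.
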